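(* Let $\delta\in(0,1)$ and suppose $$N \ge \frac{2}{(r/2)^d(\tfrac12-\eta)^2}\ln\left(\frac{1}{(r/2)^d(\tfrac12-\eta)^2\,\delta}\right)+1.$$ Then with probability at least $1-\delta$, after one synchronous best-response update, every sensor $i$ with $|w\cdot x_i|\ge r$ (i.e. at distance at least $r$ from the target separator) is in state $t(x_i)$.
   Context: Sensors $1,\dots,N$ have positions $x_1,\dots,x_N$ drawn i.i.d. uniformly from the unit ball $\{x\in\mathbb{R}^d:\|x\|\le 1\}$, $d\ge1$. The target separator is the hyperplane $\{x: w\cdot x=0\}$ for a fixed unit vector $w$, and the target label of $x$ is $t(x)=\mathrm{sign}(w\cdot x)$. Noise rate $\eta\in[0,1/2)$: conditional on the positions, the initial states in $\{+1,-1\}$ are independent across sensors, and sensor $i$'s initial state equals $t(x_i)$ with probability at least $1-\eta$. Communication radius $r\in(0,1]$: distinct sensors $i\ne j$ are neighbors if $\|x_i-x_j\|\le r$. A best-response update of sensor $i$ sets its state to the majority state among its neighbors' current states; in case of a tie (or no neighbors) the new state may be arbitrary. In a synchronous update, all sensors simultaneously perform a best-response update based on the initial states. *)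

(* Defs.v *)
From mathcomp Require Import all_boot all_order all_algebra.
From mathcomp Require Import all_classical all_reals all_analysis.
Set Implicit Arguments. Unset Strict Implicit. Unset Printing Implicit Defensive.
Import Order.TTheory GRing.Theory Num.Theory.

Local Open Scope ring_scope.

Section Defs.
Variable R : realType.

Definition dotp (d : nat) (u v : 'rV[R]_d) : R := \sum_(j < d) u 0 j * v 0 j.
Definition enorm (d : nat) (u : 'rV[R]_d) : R := Num.sqrt (dotp u u).

(** Iterated Lebesgue integral over R^n, coordinates packed in an n-tuple
    (the tuple type carries MathComp-Analysis' product sigma-algebra).
    For nonnegative measurable integrands this is the integral w.r.t.
    the n-dimensional Lebesgue measure (Tonelli). *)
Fixpoint iter_integral (n : nat) : (n.-tuple R -> \bar R) -> \bar R :=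
  match n return (n.-tuple R -> \bar R) -> \bar R with
  | 0 => fun f => f [tuple]
  | n'.+1 => fun f =>
      (\int[@lebesgue_measure R]_(t in [set: R])
          iter_integral (fun c : n'.-tuple R => f [tuple of t :: c]))%E
  end.

Definition rV_of_tuple (d : nat) (c : d.-tuple R) : 'rV[R]_d :=
  \row_(j < d) tnth c j.

Definition unit_ball_volume (d : nat) : R :=
  fine (iter_integral (fun c : d.-tuple R =>
          (if enorm (rV_of_tuple c) <= 1 then 1 else 0)%:E)).

Definition sensor_pos (N d : nat) (c : (N * d).-tuple R) (i : 'I_N) : 'rV[R]_d :=
  \row_(j < d) nth 0 (tval c) (i * d + j).

Definition state_val (b : bool) : R := if b then 1 else -1.

(** Target label t(x) = sign(w . x) (points on the hyperplane, a null set,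
    get +1). *)
Definition target (d : nat) (w x : 'rV[R]_d) : bool := 0 <= dotp w x.

Definition neighbor_sum (N d : nat) (r : R) (x : 'I_N -> 'rV[R]_d)
    (s : 'I_N -> bool) (i : 'I_N) : R :=
  \sum_(j < N | (j != i) && (enorm (x i - x j) <= r)) state_val (s j).

(** v is a possible outcome of a best-response update of sensor i
    (majority state among neighbours; arbitrary in case of a tie). *)
Definition best_response (N d : nat) (r : R) (x : 'I_N -> 'rV[R]_d)
    (s : 'I_N -> bool) (i : 'I_N) (v : bool) : Prop :=
  (0 < neighbor_sum r x s i -> v = true) /\
  (neighbor_sum r x s i < 0 -> v = false).

Definition far_sensors_correct (N d : nat) (r : R) (w : 'rV[R]_d)
    (x : 'I_N -> 'rV[R]_d) (s : 'I_N -> bool) : Prop :=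
  forall i : 'I_N, r <= `|dotp w (x i)| ->
    forall v : bool, best_response r x s i v -> v = target w (x i).

(** Conditional probability (given the positions c) of the event above, when
    the initial states are independent and sensor i's state is t(x_i) with
    probability q c i. *)
Definition cond_prob_correct (N d : nat) (r : R) (w : 'rV[R]_d)
    (q : (N * d).-tuple R -> 'I_N -> R) (c : (N * d).-tuple R) : R :=
  \sum_(s : {ffun 'I_N -> bool})
     (\prod_(i < N) (if s i == target w (sensor_pos c i)
                     then q c i else 1 - q c i)) *
     (if `[< far_sensors_correct r w (sensor_pos c) s >] then 1 else 0).

Definition all_in_unit_ball (N d : nat) (c : (N * d).-tuple R) : bool :=
  [forall i : 'I_N, enorm (sensor_pos c i) <= 1].

(** Probability, for positions i.i.d. uniform on the unit ball and states
    drawn as above, that the far sensors are correct after one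
    synchronous best-response update. *)
Definition prob_far_correct (N d : nat) (r : R) (w : 'rV[R]_d)
    (q : (N * d).-tuple R -> 'I_N -> R) : \bar R :=
  ((unit_ball_volume d ^- N)%:E *
    iter_integral (fun c : (N * d).-tuple R =>
      (if all_in_unit_ball c then cond_prob_correct r w q c else 0)%:E))%E.

End Defs.

(* Main.v *)
(* For a sensor at distance at least r from the separator, all neighbours
   share its label, except those lying exactly on the hyperplane, which form a
   null set.  The ball of radius r/2 around (1 - r/2) x_i lies in both the unit
   ball and the r-ball around x_i, so every other sensor is a neighbour with
   probability at least (r/2)^d.  With g = 1/2 - eta, weight a correct vote by
   1/(1 + 2g) and a wrong one by 1 + 2g: a wrong or tied majority makes the
   product of the weights at least 1, while the mean weight of one neighbour is
   at most 1 - 2g^2.  Integrating sensor by sensor, sensor i is wrong with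
   probability at most (1 - 2 (r/2)^d g^2)^(N-1), and a union bound over i
   concludes. *)
Require Import Defs.
From mathcomp Require Import all_boot all_order all_algebra.
From mathcomp Require Import all_classical all_reals all_analysis.
From mathcomp Require Import measurable_realfun ring lra.
Import Order.TTheory GRing.Theory Num.Theory.
Local Open Scope ring_scope.

(** * Iterated Lebesgue integrals *)

Section iter_integral_theory.
Local Open Scope ereal_scope.
Context {R : realType}.
Local Notation mu := (@lebesgue_measure R).

(** The integral of a nonnegative function is a supremum over the simple functions below it, so
    monotonicity holds for arbitrary functions, in particular for the integrand of
    [prob_far_correct]. *)
Lemma nonneg_le_integral {d} {T : measurableType d}
    (m : {measure set T -> \bar R}) (f g : T -> \bar R) :
  (forall x, 0 <= f x) -> (forall x, f x <= g x) ->
  \int[m]_(x in [set: T]) f x <= \int[m]_(x in [set: T]) g x.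
Proof.
move=> f0 fg; have g0 x : 0 <= g x := le_trans (f0 x) (fg x).
rewrite !ge0_integralTE//; apply: ge_ereal_sup => _ [h /= hf <-].
by apply: ereal_sup_ubound; exists h => //= x; exact: le_trans (hf x) (fg x).
Qed.

Lemma iter_integral_ge0 n (F : n.-tuple R -> \bar R) :
  (forall c, 0 <= F c) -> 0 <= iter_integral F.
Proof.
elim: n F => [|n IH] F F0 /=; first exact: F0.
by apply: integral_ge0 => t _; apply: IH => c; exact: F0.
Qed.

Lemma le_iter_integral n (F G : n.-tuple R -> \bar R) :
  (forall c, 0 <= F c) -> (forall c, F c <= G c) ->
  iter_integral F <= iter_integral G.
Proof.
elim: n F G => [|n IH] F G F0 FG /=; first exact: FG.
apply: nonneg_le_integral => t; first by apply: iter_integral_ge0.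
by apply: IH.
Qed.

Lemma eq_iter_integral n (F G : n.-tuple R -> \bar R) :
  F =1 G -> iter_integral F = iter_integral G.
Proof. by move=> /funext ->. Qed.

Lemma iter_integral0 n : iter_integral (fun _ : n.-tuple R => 0) = 0.
Proof.
elim: n => [//|n IH] /=.
by under eq_integral do rewrite IH; rewrite integral0.
Qed.

Lemma measurable_cons_pair {d} {T : measurableType d} n
    (F : T * n.+1.-tuple R -> \bar R) :
  measurable_fun setT F ->
  measurable_fun setT
    (fun p : (T * R) * n.-tuple R => F (p.1.1, [tuple of p.1.2 :: p.2])).
Proof.
move=> mF.
apply: (measurableT_comp mF).
apply/measurable_fun_pair => /=.
  by apply: measurableT_comp => //; exact: measurable_fst.
apply: measurable_cons => //.
exact: (measurableT_comp measurable_snd measurable_fst).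
Qed.

(** The parameter space is generalised in the induction: the head coordinate joins it, and Tonelli's
    theorem keeps measurability when that coordinate is integrated out. *)
Lemma measurable_iter_integral {d} {T : measurableType d} n
    (F : T * n.-tuple R -> \bar R) :
  measurable_fun setT F -> (forall p, 0 <= F p) ->
  measurable_fun setT (fun x => iter_integral (fun c => F (x, c))).
Proof.
elim: n d T F => [|n IH] d T F mF F0 /=.
  by apply: (measurableT_comp mF); exact: pair2_measurable.
apply: (measurable_fun_fubini_tonelli_F (m2 := mu)
  (fun p : T * R => iter_integral (fun c : n.-tuple R =>
     F (p.1, [tuple of p.2 :: c])))) => [|p]; last exact: iter_integral_ge0.
by apply: (IH _ _ (fun p : (T * R) * n.-tuple R =>
  F (p.1.1, [tuple of p.1.2 :: p.2]))) => //; exact: measurable_cons_pair.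
Qed.

(** Tonelli exchanges [t] with the head coordinate; the induction hypothesis moves [t] past the
    remaining ones while the head is fixed. *)
Lemma integral_iter_integral n (F : R * n.-tuple R -> \bar R) :
  measurable_fun setT F -> (forall p, 0 <= F p) ->
  \int[mu]_(t in [set: R]) iter_integral (fun c => F (t, c)) =
  iter_integral (fun c => \int[mu]_(t in [set: R]) F (t, c)).
Proof.
elim: n F => [|n IH] F mF F0 //=.
have mG : measurable_fun setT (fun p : R * R * n.-tuple R =>
    F (p.1.1, [tuple of p.1.2 :: p.2])) by exact: measurable_cons_pair.
rewrite (fubini_tonelli (m1 := mu) (m2 := mu)
  (fun p : R * R => iter_integral (fun c : n.-tuple R =>
     F (p.1, [tuple of p.2 :: c])))) /=; last 2 first.
- exact: (measurable_iter_integral _ _ mG).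
- by move=> p; apply: iter_integral_ge0.
apply: eq_integral => u _.
apply: (IH (fun p => F (p.1, [tuple of u :: p.2]))) => //.
apply: (measurableT_comp mF).
apply/measurable_fun_pair => //=.
by apply: measurable_cons => //; exact: measurable_cst.
Qed.

(** Tonelli for two blocks: the tail of [a] passes through [b] by induction, then its head by
    [integral_iter_integral]. *)
Lemma iter_integral_swap m n (F : m.-tuple R * n.-tuple R -> \bar R) :
  measurable_fun setT F -> (forall p, 0 <= F p) ->
  iter_integral (fun a => iter_integral (fun b => F (a, b))) =
  iter_integral (fun b => iter_integral (fun a => F (a, b))).
Proof.
elim: m F => [//|m IH] F mF F0 /=.
have mG : measurable_fun setT (fun p : (R * n.-tuple R) * m.-tuple R =>
    F ([tuple of p.1.1 :: p.2], p.1.2)).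
  apply: (measurableT_comp mF); apply/measurable_fun_pair => /=.
    apply: measurable_cons => //.
    exact: (measurableT_comp measurable_fst measurable_fst).
  exact: (measurableT_comp measurable_snd measurable_fst).
rewrite -(integral_iter_integral _
  (fun p => iter_integral (fun a => F ([tuple of p.1 :: a], p.2)))) /=.
- apply: eq_integral => t _.
  apply: (IH (fun p => F ([tuple of t :: p.1], p.2))) => //.
  apply: (measurableT_comp mF); apply/measurable_fun_pair => //=.
  by apply: measurable_cons => //; exact: measurable_cst.
- exact: (measurable_iter_integral _ _ mG).
- by move=> p; apply: iter_integral_ge0.
Qed.

Lemma measurable_cons_section {n} (F : n.+1.-tuple R -> \bar R) :
  measurable_fun setT F ->
  measurable_fun setT (fun p : R * n.-tuple R => F [tuple of p.1 :: p.2]).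
Proof. by move=> mF; apply: (measurableT_comp mF); exact: measurable_cons. Qed.

Lemma measurable_cons_cst {n} (F : n.+1.-tuple R -> \bar R) t :
  measurable_fun setT F ->
  measurable_fun setT (fun c : n.-tuple R => F [tuple of t :: c]).
Proof.
move=> mF; apply: (measurableT_comp mF).
by apply: measurable_cons => //; exact: measurable_cst.
Qed.

Lemma iter_integralD n (F G : n.-tuple R -> \bar R) :
  measurable_fun setT F -> (forall c, 0 <= F c) ->
  measurable_fun setT G -> (forall c, 0 <= G c) ->
  iter_integral (fun c => F c + G c) = iter_integral F + iter_integral G.
Proof.
elim: n F G => [//|n IH] F G mF F0 mG G0 /=.
rewrite -ge0_integralD//.
- by apply: eq_integral => t _; rewrite -IH//; exact: measurable_cons_cst.
- by move=> t _; exact: iter_integral_ge0.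
- exact: (measurable_iter_integral _ _ (measurable_cons_section _ mF)).
- by move=> t _; exact: iter_integral_ge0.
- exact: (measurable_iter_integral _ _ (measurable_cons_section _ mG)).
Qed.

Lemma iter_integral_sum n {I : Type} (s : seq I)
    (F : I -> n.-tuple R -> \bar R) :
  (forall i, measurable_fun setT (F i)) -> (forall i c, 0 <= F i c) ->
  iter_integral (fun c => \sum_(i <- s) F i c) =
  \sum_(i <- s) iter_integral (F i).
Proof.
move=> mF F0; elim: s => [|i s IH].
  rewrite big_nil -[RHS](iter_integral0 n).
  by apply: eq_iter_integral => c; rewrite big_nil.
rewrite big_cons -IH -iter_integralD//.
- by apply: eq_iter_integral => c; rewrite big_cons.
- exact: emeasurable_sum.
- by move=> c; exact: sume_ge0.
Qed.

Lemma iter_integralZl n (F : n.-tuple R -> \bar R) k :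
  measurable_fun setT F -> (forall c, 0 <= F c) -> (0 <= k)%R ->
  iter_integral (fun c => k%:E * F c) = k%:E * iter_integral F.
Proof.
move=> + + k0; elim: n F => [//|n IH] F mF F0 /=.
rewrite -ge0_integralZl_EFin//.
- by apply: eq_integral => t _; rewrite -IH//; exact: measurable_cons_cst.
- by move=> t _; exact: iter_integral_ge0.
- exact: (measurable_iter_integral _ _ (measurable_cons_section _ mF)).
Qed.

(** Both sides are the same nested integral, so this holds for any [F]; only the bracketing of the
    tuple changes. *)
Lemma iter_integral_cat m n (F : (m + n).-tuple R -> \bar R) :
  iter_integral F =
  iter_integral (fun a : m.-tuple R => iter_integral (fun b : n.-tuple R =>
    F [tuple of a ++ b])).
Proof.
elim: m F => [|m IH] F /=.
  by apply: eq_iter_integral => b; congr F; exact: val_inj.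
apply: eq_integral => t _; rewrite (IH (fun c => F [tuple of t :: c])).
apply: eq_iter_integral => a; apply: eq_iter_integral => b.
by congr F; exact: val_inj.
Qed.
End iter_integral_theory.

(** * Affine changes of variables, product integrands and null hyperplanes *)

Section iter_integral_lebesgue.
Local Open Scope classical_set_scope.
Local Open Scope ereal_scope.
Context {R : realType}.
Local Notation mu := (@lebesgue_measure R).

(** Lebesgue measure equals [s^-1] times its pushforward under [t |-> s^-1 * (t - a)]: the two agree
    on half-open intervals, which determine it. *)
Lemma integral_affine (a s : R) (f : R -> \bar R) :
  (0 < s)%R -> measurable_fun setT f -> (forall t, 0 <= f t) ->
  \int[mu]_(t in [set: R]) f (s^-1 * (t - a))%R =
  s%:E * \int[mu]_(t in [set: R]) f t.
Proof.
move=> s0 mf f0.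
have si0 : (0 <= s^-1)%R by rewrite invr_ge0 ltW.
pose phi (t : R) : measurableTypeR R := (s^-1 * (t - a))%R.
have mphi : measurable_fun setT (phi : measurableTypeR R -> measurableTypeR R).
  by apply: measurable_funM => //; exact: measurable_funB.
pose push : {measure set (measurableTypeR R) -> \bar R} :=
  measure_function_pushforward__canonical__measure_function_Measure mu mphi.
pose nu : {measure set (measurableTypeR R) -> \bar R} :=
  mscale (NngNum si0) push.
have muE A : measurable A -> mu A = nu A.
  apply: lebesgue_measure_unique => _ [[b c]] _ <-.
  rewrite /nu /= /mscale /= /pushforward /=.
  rewrite (_ : phi @^-1` _ = `](s * b + a)%R, (s * c + a)%R]%classic); last first.
    apply/seteqP; split => t; rewrite /phi /= !in_itv /=;
      by rewrite ltr_pdivlMl// ltrBrDr ler_pdivrMl// lerBlDr.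
  rewrite !lebesgue_measure_itv/= !lte_fin ltrD2r ltr_pM2l//.
  case: ifP => _; last by rewrite mule0.
  by rewrite -!EFinB opprD addrACA subrr addr0 -mulrBr -EFinM mulKf ?gt_eqF.
have -> : \int[mu]_(t in setT) f t =
    (s^-1)%:E * \int[mu]_(t in setT) f (s^-1 * (t - a))%R.
  rewrite (@eq_measure_integral _ _ _ _ nu); last by move=> A mA _; exact: muE.
  rewrite /nu ge0_integral_mscale//; congr (_ * _).
  exact: (@ge0_integral_pushforward _ _ _ _ _ _ mphi mu setT f).
by rewrite muleA -EFinM divff ?gt_eqF// mul1e.
Qed.


Lemma iter_integral_affine n (a : 'I_n -> R) (s : R) (F : n.-tuple R -> \bar R) :
  (0 < s)%R -> measurable_fun setT F -> (forall c, 0 <= F c) ->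
  iter_integral (fun c =>
    F [tuple (s^-1 * (tnth c j - a j))%R | j < n]) =
  (s ^+ n)%:E * iter_integral F.
Proof.
move=> s0; elim: n a F => [|n IH] a F mF F0 /=.
  by rewrite expr0 mul1e; congr F; exact: tuple0.
transitivity (\int[mu]_t ((s ^+ n)%:E * iter_integral (fun c : n.-tuple R =>
    F [tuple of (s^-1 * (t - a ord0))%R :: c]))).
  apply: eq_integral => t _.
  rewrite -(IH (fun j => a (lift ord0 j))); last 2 first.
    exact: measurable_cons_cst.
    by [].
  apply: eq_iter_integral => c; congr F; apply: eq_from_tnth => j.
  rewrite tnth_mktuple; have [k ->|->] := unliftP ord0 j.
    by rewrite !tnthS tnth_mktuple.
  by rewrite !tnth0.
rewrite (integral_affine (a ord0) s (fun u =>
  (s ^+ n)%:E * iter_integral (fun c : n.-tuple R => F [tuple of u :: c])))//.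
- rewrite ge0_integralZl_EFin//.
  + by rewrite muleA -EFinM exprS.
  + by move=> t _; exact: iter_integral_ge0.
  + exact: (measurable_iter_integral _ _ (measurable_cons_section _ mF)).
  + by rewrite exprn_ge0 // ltW.
- apply: measurable_funeM.
  exact: (measurable_iter_integral _ _ (measurable_cons_section _ mF)).
- by move=> t; rewrite mule_ge0 ?iter_integral_ge0// lee_fin exprn_ge0 // ltW.
Qed.

Lemma iter_integral_prod n (u : R -> R) (k : R) :
  measurable_fun setT u -> (forall t, 0 <= u t)%R ->
  \int[mu]_(t in [set: R]) (u t)%:E = k%:E ->
  iter_integral (fun c : n.-tuple R => (\prod_(j < n) u (tnth c j))%:E) =
  (k ^+ n)%:E.
Proof.
move=> mu_ u0 uk; elim: n => [|n IH] /=; first by rewrite big_ord0 expr0.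
have k0 : (0 <= k)%R.
  by rewrite -lee_fin -uk; apply: integral_ge0 => t _; rewrite lee_fin.
transitivity (\int[mu]_t ((k ^+ n)%:E * (u t)%:E)).
  apply: eq_integral => t _; rewrite muleC -IH -iter_integralZl//.
  - apply: eq_iter_integral => c; rewrite big_ord_recl tnth0 EFinM.
    by congr (_ * (_)%:E); apply: eq_bigr => j _; rewrite tnthS.
  - apply/measurable_EFinP; apply: measurable_prod => j _.
    by apply: measurableT_comp => //; exact: measurable_tnth.
  - by move=> c; rewrite lee_fin prodr_ge0.
rewrite ge0_integralZl_EFin//.
- by rewrite uk -EFinM exprSr.
- by move=> t _; rewrite lee_fin.
- exact/measurable_EFinP.
- by rewrite exprn_ge0.
Qed.

Lemma measurable_natr_bool {d} {T : measurableType d} (b : T -> bool) :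
  measurable_fun setT b -> measurable_fun setT (fun x => (b x)%:R : R).
Proof.
move=> mb; rewrite (_ : (fun x => _) = fun x => if b x then 1%R else 0%R).
  exact: measurable_fun_ifT.
by apply/funext => x; case: (b x).
Qed.

(** Induction on the dimension: if the first coefficient vanishes, the other coordinates satisfy an
    equation of the same kind. *)
Lemma iter_integral_hyperplane n (w : 'I_n -> R) (b : R) :
  (exists j, w j != 0%R) ->
  iter_integral (fun c : n.-tuple R =>
    (\sum_(j < n) w j * tnth c j == b)%R%:R%:E) = 0.
Proof.
elim: n w b => [|n IH] w b [j wj] /=; first by case: j wj.
have [w0|w0] := eqVneq (w ord0) 0%R.
  under eq_integral.
    move=> t _.
    rewrite (_ : iter_integral _ = 0); first over.
    rewrite -[RHS](IH (fun j => w (lift ord0 j)) b).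
      apply: eq_iter_integral => c.
      rewrite big_ord_recl w0 mul0r add0r; congr ((_ == _)%R%:R%:E).
      by apply: eq_bigr => i _; rewrite tnthS.
    have [k kj|j0] := unliftP ord0 j; first by exists k; rewrite -kj.
    by rewrite j0 w0 eqxx in wj.
  by rewrite integral0.
(* The first coordinate, whose coefficient is nonzero, is now integrated innermost: given the
   others, a single value solves the equation, and a point is null. *)
rewrite (integral_iter_integral n (fun p : R * n.-tuple R =>
  (\sum_(j < n.+1) w j * tnth [tuple of p.1 :: p.2] j == b)%R%:R%:E)) /=.
- rewrite -[RHS](iter_integral0 n); apply: eq_iter_integral => c.
  set S := (\sum_(j < n) w (lift ord0 j) * tnth c j)%R.
  transitivity (\int[mu]_(t in setT) (\1_[set ((b - S) / w ord0)%R] t)%:E).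
    apply: eq_integral => t _; rewrite indicE big_ord_recl tnth0.
    rewrite (eq_bigr (fun j => w (lift ord0 j) * tnth c j)%R); last first.
      by move=> i _; rewrite tnthS.
    congr (nat_of_bool _)%:R%:E; apply/eqP/idP; rewrite in_setE /=.
      by move=> <-; rewrite -/S addrK mulrAC divff// mul1r.
    by move=> ->; rewrite mulrCA divff// mulr1 subrK.
  by rewrite integral_indic// setIT; exact: lebesgue_measure_set1.
- apply/measurable_EFinP; apply: measurable_natr_bool.
  apply: measurable_fun_eqr => //; apply: measurable_sum => i.
  apply: measurable_funM => //.
  move: i; apply/measurable_fun_tnthP.
  exact: measurable_cons.
- by move=> p; rewrite lee_fin.
Qed.

End iter_integral_lebesgue.

(** * Euclidean balls and hyperplanes *)

Section euclid.
Context {R : realType} {d : nat}.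
Implicit Types u v w : 'rV[R]_d.

Lemma dotpC u v : dotp u v = dotp v u.
Proof. by apply: eq_bigr => j _; rewrite mulrC. Qed.

Lemma dotpDr w u v : dotp w (u + v) = dotp w u + dotp w v.
Proof. by rewrite -big_split; apply: eq_bigr => j _; rewrite mxE mulrDr. Qed.

Lemma dotpZr k w u : dotp w (k *: u) = k * dotp w u.
Proof. by rewrite mulr_sumr; apply: eq_bigr => j _; rewrite mxE mulrCA. Qed.

Lemma dotpBr w u v : dotp w (u - v) = dotp w u - dotp w v.
Proof. by rewrite dotpDr -scaleN1r dotpZr mulN1r. Qed.

Lemma dotp_ge0 u : 0 <= dotp u u.
Proof. by apply: sumr_ge0 => j _; rewrite -expr2 sqr_ge0. Qed.

Lemma dotp_eq0 u : dotp u u = 0 -> u = 0.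
Proof.
move=> /eqP; rewrite psumr_eq0 => [/allP u0|j _]; last by rewrite -expr2 sqr_ge0.
apply/rowP => j; rewrite mxE; apply/eqP.
by have := u0 j (mem_index_enum j); rewrite /= -expr2 sqrf_eq0.
Qed.

Lemma sqr_enorm u : enorm u ^+ 2 = dotp u u.
Proof. by rewrite sqr_sqrtr// dotp_ge0. Qed.

Lemma enorm_ge0 u : 0 <= enorm u.
Proof. exact: sqrtr_ge0. Qed.

Lemma enormZ k u : 0 <= k -> enorm (k *: u) = k * enorm u.
Proof.
move=> k0; rewrite /enorm dotpZr dotpC dotpZr mulrA -expr2 sqrtrM ?sqr_ge0//.
by rewrite sqrtr_sqr ger0_norm.
Qed.

Lemma enormN u : enorm (- u) = enorm u.
Proof. by rewrite /enorm -scaleN1r dotpZr dotpC dotpZr mulrA mulrNN !mul1r. Qed.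

Lemma dotp_le_enorm u v : `|dotp u v| <= enorm u * enorm v.
Proof.
rewrite -(@ler_pXn2r _ 2%N)// ?nnegrE ?mulr_ge0 ?enorm_ge0//.
rewrite real_normK ?num_real// exprMn !sqr_enorm.
have [v0|vn0] := eqVneq (dotp v v) 0.
  have z : dotp u v = 0.
    by rewrite (dotp_eq0 _ v0) -(scale0r 0) dotpZr mul0r.
  by rewrite z v0 expr0n /= mulr0.
have v_gt0 : 0 < dotp v v by rewrite lt0r vn0 dotp_ge0.
(* Cauchy-Schwarz: this vector is [dotp v v] times the component of [u] orthogonal to [v], and its
   squared norm is nonnegative. *)
have := dotp_ge0 (dotp v v *: u - dotp u v *: v).
set A := dotp u u; set B := dotp v v in v_gt0 *; set C := dotp u v.
have -> : dotp (B *: u - C *: v) (B *: u - C *: v) = B * (A * B - C ^+ 2).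
  rewrite dotpBr !dotpZr !(dotpC (_ - _)) !dotpBr !dotpZr (dotpC v u).
  by rewrite -/A -/B -/C; ring.
by rewrite pmulr_rge0// subr_ge0.
Qed.

Lemma enormD u v : enorm (u + v) <= enorm u + enorm v.
Proof.
rewrite -(@ler_pXn2r _ 2%N)// ?nnegrE ?addr_ge0 ?enorm_ge0//.
have := le_trans (ler_norm _) (dotp_le_enorm u v).
rewrite sqrrD !sqr_enorm dotpDr !(dotpC (u + v)) !dotpDr (dotpC v u).
lra.
Qed.

(* [x] lies in the ball of radius [r / 2] centered at [(1 - r / 2) y], which is
   contained in both the unit ball and the ball of radius [r] around [y]. *)
Lemma shrunk_ball_sub (r : R) (y x : 'rV[R]_d) : 0 < r <= 1 -> enorm y <= 1 ->
  enorm (x - (1 - r / 2) *: y) <= r / 2 ->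
  enorm x <= 1 /\ enorm (y - x) <= r.
Proof.
move=> /andP[r0 r1] y1 xy; have r2 : 0 <= 1 - r / 2 by lra.
have r2' : 0 <= r / 2 by lra.
split.
  have := enormD (x - (1 - r / 2) *: y) ((1 - r / 2) *: y).
  rewrite subrK enormZ// => /le_trans; apply.
  by have := ler_wpM2l r2 y1; lra.
have -> : y - x = (r / 2) *: y + - (x - (1 - r / 2) *: y).
  by apply/rowP => j; rewrite !mxE; ring.
apply: le_trans (enormD _ _) _; rewrite enormN enormZ//.
by have := ler_wpM2l r2' y1; lra.
Qed.

Lemma measurable_dotp {D} {T : measurableType D} (U V : T -> 'rV[R]_d) :
  (forall j, measurable_fun setT (fun x => U x 0 j)) ->
  (forall j, measurable_fun setT (fun x => V x 0 j)) ->
  measurable_fun setT (fun x => dotp (U x) (V x)).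
Proof.
by move=> mU mV; apply: measurable_sum => j; exact: measurable_funM.
Qed.

Lemma measurable_enorm {D} {T : measurableType D} (U : T -> 'rV[R]_d) :
  (forall j, measurable_fun setT (fun x => U x 0 j)) ->
  measurable_fun setT (fun x => enorm (U x)).
Proof.
move=> mU; have ms : measurable_fun setT (@Num.sqrt R).
  apply: continuous_measurable_fun => x; exact: sqrt_continuous.
by apply: (measurableT_comp ms); exact: measurable_dotp.
Qed.

Lemma measurable_rV_of_tuple {D} {T : measurableType D} (f : T -> d.-tuple R) j :
  measurable_fun setT f ->
  measurable_fun setT (fun x => rV_of_tuple (f x) 0 j).
Proof.
move=> mf; rewrite [X in measurable_fun _ X](_ : _ = fun x => tnth (f x) j).
  by move: j; apply/measurable_fun_tnthP.
by apply/funext => x; rewrite mxE.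
Qed.

End euclid.

(** * Volumes of cubes and balls *)

Section ball_volume.
Local Open Scope ereal_scope.
Local Open Scope classical_set_scope.
Context {R : realType}.
Local Notation mu := (@lebesgue_measure R).

Lemma integral_centered_itv (k : R) : (0 < k)%R ->
  \int[mu]_(t in [set: R]) (`|t| <= k)%R%:R%:E = (2 * k)%:E.
Proof.
move=> k0; transitivity (\int[mu]_(t in setT) (\1_`[(- k)%R, k] t)%:E).
  apply: eq_integral => t _; rewrite indicE; congr (nat_of_bool _)%:R%:E.
  by rewrite ler_norml; apply/idP/idP; rewrite in_setE /= in_itv.
rewrite integral_indic// setIT.
apply: etrans (lebesgue_measure_itv (Interval (BLeft (- k)%R) (BRight k))) _.
rewrite /= lte_fin.
by rewrite ifT ?gtrN// -EFinB; congr (_%:E); ring.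
Qed.

Lemma iter_integral_cube n (k : R) : (0 < k)%R ->
  iter_integral (fun c : n.-tuple R =>
    (\prod_(j < n) (`|tnth c j| <= k)%R%:R)%:E) =
  ((2 * k) ^+ n)%:E.
Proof.
move=> k0; apply: (iter_integral_prod _ (fun t => (`|t| <= k)%R%:R)).
- by apply: measurable_natr_bool; apply: measurable_fun_ler.
- by [].
- exact: integral_centered_itv.
Qed.

Lemma prodr_natr_bool {I : finType} (b : I -> bool) :
  (\prod_i (b i)%:R = [forall i, b i]%:R :> R)%R.
Proof.
have [/forallP h|/forallPn[i /negbTE bi]] := boolP [forall i, b i].
  by rewrite big1// => i _; rewrite h.
by rewrite (bigD1 i)//= bi mul0r.
Qed.

(** The ball lies between the cubes of half-sides [1 / d] and 1. Finiteness matters because [fine]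
    would send an infinite integral to 0. *)
Lemma iter_integral_ball d : (0 < d)%N ->
  iter_integral (fun c : d.-tuple R =>
     (enorm (rV_of_tuple c) <= 1)%R%:R%:E) = (unit_ball_volume R d)%:E /\
  (0 < unit_ball_volume R d)%R.
Proof.
move=> d0; set J := iter_integral _.
have JE : unit_ball_volume R d = fine J.
  by congr fine; apply: eq_iter_integral => c; case: ifP.
have d1 : (0 < d%:R^-1 :> R)%R by rewrite invr_gt0 ltr0n.
have J_lt : J <= ((2 * 1) ^+ d)%:E.
  rewrite -iter_integral_cube//; apply: le_iter_integral => c; rewrite !lee_fin//.
  rewrite prodr_natr_bool ler_nat.
  case: (leP _ 1%R) => // c1; rewrite (_ : [forall _, _])//.
  apply/forallP => j; apply: le_trans c1.
  rewrite -sqrtr_sqr; apply: ler_wsqrtr.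
  rewrite /dotp (bigD1 j)//= mxE -expr2 lerDl sumr_ge0// => i _.
  by rewrite -expr2 sqr_ge0.
have J_gt : ((2 * d%:R^-1) ^+ d)%:E <= J.
  rewrite -iter_integral_cube//.
  apply: le_iter_integral => c; rewrite !lee_fin ?prodr_ge0//.
  rewrite prodr_natr_bool ler_nat.
  case: forallP => // h; rewrite (_ : (_ <= 1)%R)//.
  rewrite -[leRHS]sqrtr1; apply: ler_wsqrtr.
  (* Each squared coordinate is at most [1 / d ^ 2], hence at most [1 / d], and there are [d] of
     them. *)
  apply: (@le_trans _ _ (\sum_(j < d) d%:R^-1)%R).
    apply: ler_sum => j _; rewrite mxE -expr2 -real_normK ?num_real// expr2.
    apply: le_trans (ler_pM _ _ (h j) (h j)) _ => //.
    by rewrite ler_piMl ?(ltW d1)// invf_le1 ?ltr0n// ler1n.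
  rewrite sumr_const card_ord -[X in (X *+ _)%R]mul1r -mulrnAl divff//.
  by rewrite pnatr_eq0 -lt0n.
have Jpos : 0 < J.
  by apply: lt_le_trans J_gt; rewrite lte_fin exprn_gt0// mulr_gt0.
have Jfin : J \is a fin_num.
  by rewrite ge0_fin_numE ?(ltW Jpos)//; apply: le_lt_trans J_lt _; rewrite ltry.
rewrite JE fineK//; split => //.
by rewrite -lte_fin fineK.
Qed.

Lemma iter_integral_ball_affine d (a : 'rV[R]_d) (s : R) :
  (0 < d)%N -> (0 < s)%R ->
  iter_integral (fun c : d.-tuple R => (enorm (rV_of_tuple c - a) <= s)%R%:R%:E) =
  (s ^+ d * unit_ball_volume R d)%:E.
Proof.
move=> d0 s0; have [/= VE _] := iter_integral_ball _ d0.
rewrite EFinM -VE.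
rewrite -(iter_integral_affine _ (fun j => a 0%R j) s (fun c : d.-tuple R =>
  (enorm (rV_of_tuple c) <= 1)%R%:R%:E))//.
- apply: eq_iter_integral => c; congr (nat_of_bool _)%:R%:E.
  rewrite [X in (enorm X <= 1)%R](_ : _ = s^-1 *: (rV_of_tuple c - a)).
    by rewrite enormZ ?invr_ge0 ?(ltW s0)// ler_pdivrMl// mulr1.
  by apply/rowP => j; rewrite !mxE tnth_mktuple.
- apply/measurable_EFinP/measurable_natr_bool/measurable_fun_ler => //.
  by apply: measurable_enorm => j; apply: measurable_rV_of_tuple.
Qed.

End ball_volume.

(** * Integration sensor by sensor *)

Section blocks.
Local Open Scope ereal_scope.
Context {R : realType} {d : nat}.

(** [N.+1 * d] computes to [d + N * d], so the coordinates of the first sensor split off without a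
    cast. *)
Lemma iter_integral_blocks N (F : (N.+1 * d).-tuple R -> \bar R) :
  iter_integral F = iter_integral (fun a : d.-tuple R =>
    iter_integral (fun b : (N * d).-tuple R => F [tuple of a ++ b])).
Proof. exact: (iter_integral_cat d (N * d) F). Qed.

Lemma sensor_pos_cat0 N (a : d.-tuple R) (b : (N * d).-tuple R) :
  sensor_pos ([tuple of a ++ b] : (N.+1 * d).-tuple R) ord0 = rV_of_tuple a.
Proof.
apply/rowP => j; rewrite !mxE /= mul0n add0n nth_cat size_tuple ltn_ord.
by rewrite (tnth_nth 0%R).
Qed.

Lemma sensor_pos_catS N (a : d.-tuple R) (b : (N * d).-tuple R) k :
  sensor_pos ([tuple of a ++ b] : (N.+1 * d).-tuple R) (lift ord0 k) =
  sensor_pos b k.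
Proof.
apply/rowP => j; rewrite !mxE lift0 nth_cat size_tuple mulSn.
by rewrite -addnA ltnNge leq_addr /= addKn.
Qed.

(** A position as a tuple, the type that carries the product sigma-algebra; measurability in the
    positions is proved through it. *)
Definition block {N} (i : 'I_N) (c : (N * d).-tuple R) : d.-tuple R :=
  [tuple sensor_pos c i 0%R j | j < d].

Lemma rV_of_block N (i : 'I_N) (c : (N * d).-tuple R) :
  rV_of_tuple (block i c) = sensor_pos c i.
Proof. by apply/rowP => j; rewrite mxE tnth_mktuple. Qed.

Lemma measurable_block N (i : 'I_N) : measurable_fun setT (@block N i).
Proof.
apply/measurable_fun_tnthP => j /=.
(* The index is in range, so the default value of [nth] in [sensor_pos] is never read. *)
have ltij : (i * d + j < N * d)%N.
  apply: leq_trans (leq_mul (ltn_ord i) (leqnn d)).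
  by rewrite mulSn addnC ltn_add2r.
rewrite (_ : _ \o _ = fun c : (N * d).-tuple R => tnth c (Ordinal ltij)).
  exact: measurable_tnth.
by apply/funext => c; rewrite /= tnth_mktuple mxE (tnth_nth 0%R).
Qed.

Lemma measurable_block1 N (i : 'I_N) (u : 'rV[R]_d -> R) :
  measurable_fun setT (fun a : d.-tuple R => u (rV_of_tuple a)) ->
  measurable_fun setT (fun c : (N * d).-tuple R => u (sensor_pos c i)).
Proof.
move=> mu_.
rewrite (_ : (fun c => _) = (fun a => u (rV_of_tuple a)) \o block i).
  by apply: measurableT_comp => //; exact: measurable_block.
by apply/funext => c /=; rewrite rV_of_block.
Qed.

Lemma measurable_block2 N (i j : 'I_N) (phi : 'rV[R]_d -> 'rV[R]_d -> R) :
  measurable_fun setT (fun p : d.-tuple R * d.-tuple R =>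
    phi (rV_of_tuple p.1) (rV_of_tuple p.2)) ->
  measurable_fun setT (fun c : (N * d).-tuple R =>
    phi (sensor_pos c i) (sensor_pos c j)).
Proof.
move=> mphi.
have mij : measurable_fun setT
    (fun c : (N * d).-tuple R => (block i c, block j c)).
  by apply/measurable_fun_pair; exact: measurable_block.
rewrite (_ : (fun c => _) = (fun p : d.-tuple R * d.-tuple R =>
    phi (rV_of_tuple p.1) (rV_of_tuple p.2)) \o
    (fun c => (block i c, block j c))).
  exact: measurableT_comp.
by apply/funext => c /=; rewrite !rV_of_block.
Qed.

(** Independence of the positions: the integral factors sensor by sensor. *)
Lemma iter_integral_prod_blocks N (u : 'rV[R]_d -> R) (k : R) :
  measurable_fun setT (fun a : d.-tuple R => u (rV_of_tuple a)) ->
  (forall x, 0 <= u x)%R ->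
  iter_integral (fun a : d.-tuple R => (u (rV_of_tuple a))%:E) = k%:E ->
  iter_integral (fun c : (N * d).-tuple R =>
    (\prod_(j < N) u (sensor_pos c j))%:E) = (k ^+ N)%:E.
Proof.
move=> mu_ u0 uk; have k0 : (0 <= k)%R.
  by rewrite -lee_fin -uk; apply: iter_integral_ge0 => a; rewrite lee_fin.
elim: N => [|N IH]; first by rewrite /= big_ord0 expr0.
rewrite iter_integral_blocks.
transitivity (iter_integral (fun a : d.-tuple R =>
    (k ^+ N)%:E * (u (rV_of_tuple a))%:E)).
  apply: eq_iter_integral => a; rewrite muleC -IH -iter_integralZl//.
  - apply: eq_iter_integral => c; rewrite big_ord_recl EFinM sensor_pos_cat0.
    by congr (_ * (_)%:E); apply: eq_bigr => j _; rewrite sensor_pos_catS.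
  - apply/measurable_EFinP; apply: measurable_prod => j _.
    exact: measurable_block1.
  - by move=> c; rewrite lee_fin prodr_ge0.
rewrite iter_integralZl//.
- by rewrite uk -EFinM exprSr.
- exact/measurable_EFinP.
- by move=> a; rewrite lee_fin.
- by rewrite exprn_ge0.
Qed.

(** Given the position of the centre [i], the other sensors are independent and contribute at most
    [K] each. The induction removes the first sensor; [h] is general so that it can absorb the
    factor of a removed sensor other than [i]. *)
Lemma iter_integral_star_le N (i : 'I_N.+1) (h : 'rV[R]_d -> R)
    (phi : 'rV[R]_d -> 'rV[R]_d -> R) (K : R) :
  measurable_fun setT (fun a : d.-tuple R => h (rV_of_tuple a)) ->
  measurable_fun setT (fun p : d.-tuple R * d.-tuple R =>
    phi (rV_of_tuple p.1) (rV_of_tuple p.2)) ->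
  (forall x, 0 <= h x)%R -> (forall x y, 0 <= phi x y)%R ->
  (forall y, iter_integral (fun a : d.-tuple R => (phi y (rV_of_tuple a))%:E)
     <= K%:E) ->
  iter_integral (fun c : (N.+1 * d).-tuple R =>
    (h (sensor_pos c i) *
     \prod_(j < N.+1 | j != i) phi (sensor_pos c i) (sensor_pos c j))%:E) <=
  (K ^+ N)%:E * iter_integral (fun a : d.-tuple R => (h (rV_of_tuple a))%:E).
Proof.
move=> mh mphi h0 phi0 phiK.
have K0 : (0 <= K)%R.
  rewrite -lee_fin; apply: le_trans (phiK 0%R).
  by apply: iter_integral_ge0 => a; rewrite lee_fin.
have mphi1 (a : d.-tuple R) :
    measurable_fun setT
      (fun b : d.-tuple R => phi (rV_of_tuple a) (rV_of_tuple b)).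
  exact: (measurableT_comp mphi (pair1_measurable a)).
have mphi2 (b : d.-tuple R) :
    measurable_fun setT
      (fun a : d.-tuple R => phi (rV_of_tuple a) (rV_of_tuple b)).
  exact: (measurableT_comp mphi (pair2_measurable b)).
elim: N i h mh h0 => [|N IH] i h mh h0; rewrite iter_integral_blocks.
all: have [k ->|->] := unliftP ord0 i.
- by case: k.
- rewrite expr0 mul1e; apply: le_iter_integral => a.
    by apply: iter_integral_ge0 => b; rewrite lee_fin mulr_ge0// prodr_ge0.
  rewrite /= big_mkcond big_ord_recl big_ord0 /= !mulr1.
  by have := sensor_pos_cat0 0 a [tuple] => /= ->.
(* The first sensor, at [a], is not the centre: the induction hypothesis is applied to [h] times
   [phi] at [a]. *)
- apply: (@le_trans _ _ (iter_integral (fun a : d.-tuple R => (K ^+ N)%:E *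
    iter_integral (fun b : d.-tuple R => (h (rV_of_tuple b) *
      phi (rV_of_tuple b) (rV_of_tuple a))%:E)))).
    apply: le_iter_integral => a.
      by apply: iter_integral_ge0 => b; rewrite lee_fin mulr_ge0// prodr_ge0.
    apply: le_trans (IH k (fun x => h x * phi x (rV_of_tuple a))%R _ _).
    + apply: le_iter_integral => b; first by rewrite lee_fin mulr_ge0// prodr_ge0.
      rewrite big_mkcond big_ord_recl /= sensor_pos_catS sensor_pos_cat0 mulrA.
      rewrite [in leRHS]big_mkcond /= lee_fin le_eqVlt; apply/orP; left.
      apply/eqP; congr (_ * _)%R; apply: eq_bigr => j _.
      by rewrite sensor_pos_catS (inj_eq lift_inj).
    + exact: measurable_funM.
    + by move=> x; rewrite mulr_ge0.
  have mg : measurable_fun setT (fun p : d.-tuple R * d.-tuple R =>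
      (h (rV_of_tuple p.2) * phi (rV_of_tuple p.2) (rV_of_tuple p.1))%:E).
    apply/measurable_EFinP; apply: measurable_funM.
      exact: (measurableT_comp mh measurable_snd).
    have ms : measurable_fun setT
        (fun p : d.-tuple R * d.-tuple R => (p.2, p.1)) by exact: measurable_swap.
    exact (measurableT_comp mphi ms).
  rewrite iter_integralZl ?exprn_ge0//; last 2 first.
  + apply: (measurable_iter_integral _ _ mg) => p.
    by rewrite lee_fin mulr_ge0.
  + by move=> a; apply: iter_integral_ge0 => b; rewrite lee_fin mulr_ge0.
  (* The bound [K] concerns integration over the second argument of [phi], so [a] has to become the
     inner variable. *)
  rewrite (iter_integral_swap _ _ _ mg) /=; last first.
    by move=> p; rewrite lee_fin mulr_ge0.
  rewrite exprSr EFinM -muleA; apply: lee_wpmul2l.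
    by rewrite lee_fin exprn_ge0.
  rewrite -iter_integralZl//; last 2 first.
  + exact/measurable_EFinP.
  + by move=> b; rewrite lee_fin.
  apply: le_iter_integral => b.
    by apply: iter_integral_ge0 => a; rewrite lee_fin mulr_ge0.
  under [leLHS]eq_iter_integral do rewrite EFinM.
  rewrite iter_integralZl// 1?muleC.
  + by apply: lee_wpmul2r => //; rewrite lee_fin.
  + exact/measurable_EFinP.
  + by move=> a; rewrite lee_fin.
(* The first sensor is the centre: with [a] fixed, the remaining integrand is a plain product over
   sensors. *)
- apply: (@le_trans _ _ (iter_integral (fun a : d.-tuple R =>
    (K ^+ N.+1)%:E * (h (rV_of_tuple a))%:E))); last first.
    rewrite iter_integralZl// ?exprn_ge0//.
    + exact/measurable_EFinP.
    + by move=> a; rewrite lee_fin.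
  apply: le_iter_integral => a.
    by apply: iter_integral_ge0 => b; rewrite lee_fin mulr_ge0// prodr_ge0.
  set k := fine (iter_integral (fun b : d.-tuple R =>
    (phi (rV_of_tuple a) (rV_of_tuple b))%:E)).
  have I0 : 0 <= iter_integral (fun b : d.-tuple R =>
      (phi (rV_of_tuple a) (rV_of_tuple b))%:E).
    by apply: iter_integral_ge0 => b; rewrite lee_fin.
  have kE : iter_integral (fun b : d.-tuple R =>
      (phi (rV_of_tuple a) (rV_of_tuple b))%:E) = k%:E.
    rewrite fineK// ge0_fin_numE//.
    by apply: le_lt_trans (phiK _) _; rewrite ltry.
  have k0 : (0 <= k)%R by rewrite -lee_fin -kE.
  have kK : (k <= K)%R by rewrite -lee_fin -kE.
  rewrite (eq_iter_integral _ _ (fun b : (N.+1 * d).-tuple R =>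
    (h (rV_of_tuple a))%:E *
    (\prod_(j < N.+1) phi (rV_of_tuple a) (sensor_pos b j))%:E)); last first.
    move=> b /=; rewrite big_mkcond big_ord_recl eqxx /=.
    rewrite sensor_pos_cat0 mul1r EFinM.
    by congr (_ * _%:E); apply: eq_bigr => j _; rewrite sensor_pos_catS.
  rewrite iter_integralZl//.
  + rewrite (iter_integral_prod_blocks _ _ k)// muleC.
    apply: lee_wpmul2r; first by rewrite lee_fin.
    by rewrite lee_fin lerXn2r// nnegrE.
  + apply/measurable_EFinP; apply: measurable_prod => j _.
    exact: (measurable_block1 _ _ (phi (rV_of_tuple a))).
  + by move=> b; rewrite lee_fin prodr_ge0.
Qed.

End blocks.

(** * Exponential weights of the votes *)

Section chernoff.
Context {R : realType} {d : nat}.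
Context (r g : R) (w : 'rV[R]_d).

(* Upper bound for the mean weight, in the vote of a far sensor at [y], of a
   sensor at [x]; on the hyperplane the two labels may differ, which the last
   term pays for. *)
Definition chernoff_factor (y x : 'rV[R]_d) : R :=
  1 - 2 * g ^+ 2 * (enorm (x - (1 - r / 2) *: y) <= r / 2)%R%:R +
  2 * (dotp w x == 0)%R%:R.

Lemma chernoff_factor_ge0 y x : 0 <= g <= 1 / 2 -> 0 <= chernoff_factor y x.
Proof.
rewrite /chernoff_factor => g01.
by case: (enorm _ <= _); case: (dotp w x == 0) => /=; nra.
Qed.

(** By Cauchy-Schwarz, [dotp w x] and [dotp w y] differ by at most [r], so [x] cannot lie strictly
    beyond the separator. The hyperplane is excluded because [target] labels it positive even when
    [y] is on the negative side. *)
Lemma target_near (x y : 'rV[R]_d) : enorm w = 1 -> r <= `|dotp w y| ->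
  enorm (y - x) <= r -> dotp w x != 0 -> target w x = target w y.
Proof.
move=> w1 ry xy x0; rewrite /target.
have := le_trans (dotp_le_enorm w (y - x)) _ => /(_ r).
rewrite w1 mul1r => /(_ xy); rewrite dotpBr ler_norml => /andP[h1 h2].
have r0 := le_trans (enorm_ge0 _) xy.
move: ry; rewrite ler_normr => /orP[ry|ry].
  have hx : 0 <= dotp w x by lra.
  have hy : 0 <= dotp w y by lra.
  by rewrite hx hy.
have hx : dotp w x <= 0 by lra.
have x_lt0 : dotp w x < 0 by rewrite lt_neqAle x0.
have y_lt0 : dotp w y < 0 by lra.
by rewrite !leNgt x_lt0 y_lt0.
Qed.

Context {N : nat}.
Context (x : 'I_N -> 'rV[R]_d).

(** The exponential form turns a product of weights into the exponential of a multiple of the vote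
    sum. Sensors that are not neighbours of [i], and [i] itself, weigh 1, so products can run over
    all sensors. *)
Let vote_weight (i j : 'I_N) (b : bool) : R :=
  if (j != i) && (enorm (x i - x j) <= r)
  then expR (- ln (1 + 2 * g) * (state_val R (target w (x i)) * state_val R b))
  else 1.

(** A wrong state is a best response only if the label of [i] times its neighbour sum is at most 0,
    ties included; the exponent of the product is then nonnegative. *)
Lemma incorrect_vote (s : 'I_N -> bool) : 0 <= g ->
  ~ far_sensors_correct r w x s ->
  exists2 i, r <= `|dotp w (x i)| & 1 <= \prod_j vote_weight i j (s j).
Proof.
move=> g0 /existsNP[i /not_implyP[fari /existsNP[v /not_implyP[[hp hn] vi]]]].
exists i => //; rewrite -big_mkcond -expR_sum -mulr_sumr -mulr_sumr.
rewrite -[leLHS]expR0 ler_expR mulNr oppr_ge0 -/(neighbor_sum r x s i).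
apply: mulr_ge0_le0; first by apply: ln_ge0; rewrite lerDl mulr_ge0.
move: vi hp hn; rewrite /state_val.
case: (target w (x i)); case: v => // _ hp hn.
  rewrite mul1r leNgt; apply/negP => /hp //.
rewrite mulN1r oppr_le0 leNgt; apply/negP => /hn //.
Qed.

(** Three cases for [j]: not a neighbour (mean 1), a neighbour on the hyperplane (mean at most 2),
    and a neighbour off it, which shares the label of [i] (mean at most [1 - 2 * g ^+ 2]). *)
Lemma vote_weight_mean (q : 'I_N -> R) i j :
  0 <= g <= 1 / 2 -> 0 < r <= 1 -> enorm w = 1 ->
  1 / 2 + g <= q j <= 1 ->
  r <= `|dotp w (x i)| -> enorm (x i) <= 1 -> j != i ->
  \sum_(b : bool) (if b == target w (x j) then q j else 1 - q j) *
     vote_weight i j b <= chernoff_factor (x i) (x j).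
Proof.
move=> g01 r01 w1 qj fari xi1 ji.
have z0 : 0 < 1 + 2 * g by lra.
set z := 1 + 2 * g in z0 *.
have zV : z * z^-1 = 1 by rewrite divff ?gt_eqF.
have zV0 : 0 < z^-1 by rewrite invr_gt0.
have zV1 : z^-1 <= 1 by rewrite invf_le1// /z; lra.
(* The left side decreases in [q j] because [z^-1 <= z]; at [q j = 1 / 2 + g = z / 2] it equals the
   right side exactly. *)
have qz : q j * z^-1 + (1 - q j) * z <= 1 - 2 * g ^+ 2.
  have : (q j - (1 / 2 + g)) * (z^-1 - z) <= 0.
    by apply: mulr_ge0_le0; rewrite /z in zV1 *; lra.
  move: zV; rewrite /z; nra.
(* A crude bound for opposite labels: both weights are at most [z <= 2]. *)
have qz' : (1 - q j) * z^-1 + q j * z <= 2.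
  by rewrite /z in zV1 *; nra.
have wE b c : expR (- ln z * (state_val R b * state_val R c)) =
    if b == c then z^-1 else z.
  have lnz : expR (ln z) = z by rewrite lnK.
  by case: b; case: c; rewrite /state_val /= ?mulN1r ?mulNr ?mul1r ?mulrN ?mulr1
    ?opprK ?expRN ?lnz.
rewrite big_bool /vote_weight ji -/z !andTb !wE /chernoff_factor.
have [near|far] := leP (enorm (x i - x j)) r; last first.
  (* The shrunk ball contains only points within [r] of [x i], so the factor keeps no decrease
     here. *)
  have -> : (enorm (x j - (1 - r / 2) *: x i) <= r / 2) = false.
    apply/negP => h; have [_] := shrunk_ball_sub _ _ _ r01 xi1 h.
    by rewrite leNgt far.
  have : 0 <= (dotp w (x j) == 0)%R%:R :> R by [].
  by case: (target w (x j)) => /=; lra.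
have [xj0|xj0] := eqVneq (dotp w (x j)) 0.
  rewrite /= mulr1.
  have : 2 <= 1 - 2 * g ^+ 2 *
      (enorm (x j - (1 - r / 2) *: x i) <= r / 2)%R%:R + 2.
    by case: (enorm _ <= _) => /=; nra.
  apply: le_trans.
  have := qz.
  case: (target w (x j)); case: (target w (x i)) => /=; nra.
rewrite (target_near _ _ w1 fari near xj0) /= mulr0 addr0.
apply: (@le_trans _ _ (1 - 2 * g ^+ 2)).
  by case: (target w (x i)) => /=; lra.
by case: (enorm _ <= _) => /=; nra.
Qed.

(** A Chernoff bound with a union bound: for every state vector, 1 is at most the indicator of
    correctness plus the weight products of the far sensors. Averaging over independent states
    factors each product. *)
Lemma correct_prob_lower (q : 'I_N -> R) :
  0 <= g <= 1 / 2 -> 0 < r <= 1 -> enorm w = 1 ->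
  (forall i, 1 / 2 + g <= q i <= 1) -> (forall i, enorm (x i) <= 1) ->
  1 <= \sum_(s : {ffun 'I_N -> bool})
         (\prod_(i < N) (if s i == target w (x i) then q i else 1 - q i)) *
         (if `[< far_sensors_correct r w x s >] then 1 else 0) +
       \sum_(i < N) \prod_(j < N | j != i) chernoff_factor (x i) (x j).
Proof.
move=> g01 r01 w1 q01 x1.
pose p i b := if b == target w (x i) then q i else 1 - q i.
have p0 i b : 0 <= p i b by rewrite /p; have := q01 i; case: eqP; lra.
have sum_p i : \sum_b p i b = 1.
  by rewrite big_bool /p; case: (target w (x i)) => /=; ring.
(* Independence of the states, as distributivity of the product over the sums. *)
have sumP (f : 'I_N -> bool -> R) :
    \sum_(s : {ffun 'I_N -> bool}) \prod_i f i (s i) = \prod_i \sum_b f i b.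
  by rewrite bigA_distr_bigA.
have total : \sum_(s : {ffun 'I_N -> bool}) \prod_i p i (s i) = 1.
  by rewrite sumP big1.
rewrite -[leLHS]total.
pose E i (s : {ffun 'I_N -> bool}) : R :=
  if r <= `|dotp w (x i)| then \prod_j vote_weight i j (s j) else 0.
have vw0 i j b : 0 <= vote_weight i j b.
  by rewrite /vote_weight; case: ifP => // _; exact: expR_ge0.
have E0 i s : 0 <= E i s by rewrite /E; case: ifP => // _; exact: prodr_ge0.
have mean i : \sum_(s : {ffun 'I_N -> bool}) (\prod_j p j (s j)) * E i s <=
    \prod_(j < N | j != i) chernoff_factor (x i) (x j).
  have [fari|/negbTE fari] := boolP (r <= `|dotp w (x i)|); last first.
    rewrite /E fari big1 => [|s _]; last by rewrite mulr0.
    by apply: prodr_ge0 => j _; exact: chernoff_factor_ge0.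
  rewrite /E fari (eq_bigr (fun s : {ffun 'I_N -> bool} =>
    \prod_j (p j (s j) * vote_weight i j (s j)))); last first.
    by move=> s _; rewrite big_split.
  rewrite (sumP (fun j b => p j b * vote_weight i j b)) (bigD1 i)//=.
  (* Sensor [i] does not vote for itself: its weight is 1, and its probabilities sum to 1. *)
  rewrite [X in X * _](_ : _ = 1) ?mul1r.
    apply: ler_prod => j ji; rewrite sumr_ge0 => [/=|b _]; last exact: mulr_ge0.
    exact: vote_weight_mean.
  rewrite -[RHS](sum_p i); apply: eq_bigr => b _.
  by rewrite /vote_weight eqxx mulr1.
apply: (@le_trans _ _ (\sum_(s : {ffun 'I_N -> bool}) (\prod_i p i (s i)) *
   ((if `[< far_sensors_correct r w x s >] then 1 else 0) + \sum_i E i s))).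
  apply: ler_sum => s _; rewrite -[leLHS]mulr1; apply: ler_wpM2l.
    by apply: prodr_ge0.
  case: asboolP => [_|/incorrect_vote].
    by rewrite lerDl sumr_ge0.
  case=> [|i fari vi]; first by case/andP: g01.
  rewrite add0r (bigD1 i)//= /E fari; apply: le_trans vi _.
  by rewrite lerDl; apply: sumr_ge0 => k _; exact: E0.
have -> : \sum_(s : {ffun 'I_N -> bool}) (\prod_i p i (s i)) *
     ((if `[< far_sensors_correct r w x s >] then 1 else 0) + \sum_i E i s) =
   \sum_(s : {ffun 'I_N -> bool}) (\prod_i p i (s i)) *
     (if `[< far_sensors_correct r w x s >] then 1 else 0) +
   \sum_i \sum_(s : {ffun 'I_N -> bool}) (\prod_j p j (s j)) * E i s.
  rewrite exchange_big -big_split /=; apply: eq_bigr => s _.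
  by rewrite mulrDr mulr_sumr.
by rewrite lerD2l; apply: ler_sum => i _; exact: mean.
Qed.

End chernoff.

(** * Union bound *)

(** The hypothesis gives [expR (- (a * m)) <= (a * delta) ^+ 2], while [(1 - 2 * a) ^+ m] is at most
    the square of this exponential. One copy absorbs [a * (m + 1) <= 1 + a * m <= expR (a * m)]; the
    other leaves [(a * delta) ^+ 2 <= a * delta]. *)
Lemma union_bound_le {R : realType} (a delta : R) (m : nat) :
  0 < a <= 1 / 2 -> 0 < delta < 1 ->
  2 / a * ln (1 / (a * delta)) <= m%:R ->
  m.+1%:R * (1 - 2 * a) ^+ m <= delta.
Proof.
move=> /andP[a0 a1] /andP[d0 d1] hm.
have ad0 : 0 < a * delta by exact: mulr_gt0.
have am : 2 * ln (1 / (a * delta)) <= a * m%:R.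
  have := ler_wpM2l (ltW a0) hm.
  by rewrite mulrA mulrCA divff ?gt_eqF// mulr1.
have e1 : expR (- (a * m%:R)) <= (a * delta) ^+ 2.
  apply: (@le_trans _ _ (expR (- (2 * ln (1 / (a * delta)))))).
    by rewrite ler_expR lerN2.
  rewrite div1r lnV ?posrE// mulrN opprK expRM_natl lnK// posrE//.
have e2 : (1 - 2 * a) ^+ m <= expR (- (a * m%:R)) ^+ 2.
  apply: (@le_trans _ _ (expR (- (2 * a)) ^+ m)).
    apply: lerXn2r; rewrite ?nnegrE ?expR_ge0//; first by lra.
    by have := expR_ge1Dx (- (2 * a)).
  rewrite -!expRM_natl ler_expR le_eqVlt; apply/orP; left; apply/eqP; ring.
have e3 : a * m.+1%:R * expR (- (a * m%:R)) <= 1.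
  rewrite expRN ler_pdivrMr ?expR_gt0// mul1r.
  apply: le_trans (expR_ge1Dx _).
  by rewrite -natr1 mulrDr mulr1; lra.
rewrite -(ler_pM2l a0) mulrA.
apply: le_trans (ler_wpM2l _ e2) _; first by rewrite mulr_ge0// ltW.
rewrite expr2 mulrA.
apply: le_trans (ler_pM _ _ e3 e1) _; rewrite ?expR_ge0//.
  by rewrite !mulr_ge0 ?expR_ge0// ltW.
rewrite mul1r expr2 ger_pMl//.
by rewrite mulr_ile1 ?(ltW a0) ?(ltW d0)//; lra.
Qed.

(** * Averaging over positions uniform in the unit ball *)

Section separator.
Local Open Scope ereal_scope.
Context {R : realType} {d : nat}.
Context (r g : R) (w : 'rV[R]_d).
Context (d0 : (0 < d)%N) (g01 : (0 <= g <= 1 / 2)%R) (r01 : (0 < r <= 1)%R)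
  (w1 : enorm w = 1%R).

Let V : R := unit_ball_volume R d.
(** A uniform point lies in the shrunk ball with probability [(r / 2) ^+ d], which lowers the factor
    by [2 * g ^+ 2]; the mean decrease is [2 * a]. *)
Let a : R := ((r / 2) ^+ d * g ^+ 2)%R.
Let B (y : 'rV[R]_d) : R := (enorm y <= 1)%R%:R.
(** The indicators [B] restrict integrals over the whole space to the unit ball. *)
Let phi (y x : 'rV[R]_d) : R := (B y * B x * chernoff_factor r g w y x)%R.

Let V0 : (0 < V)%R. Proof. by have [] := iter_integral_ball (R := R) _ d0. Qed.

Let B_ge0 y : (0 <= B y)%R. Proof. by []. Qed.

Let measurable_B {D} {T : measurableType D} (f : T -> d.-tuple R) :
  measurable_fun setT f -> measurable_fun setT (fun x => B (rV_of_tuple (f x))).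
Proof.
move=> mf; apply: measurable_natr_bool; apply: measurable_fun_ler => //.
by apply: measurable_enorm => j; exact: measurable_rV_of_tuple.
Qed.

Let measurable_chernoff {D} {T : measurableType D} (f h : T -> d.-tuple R) :
  measurable_fun setT f -> measurable_fun setT h ->
  measurable_fun setT
    (fun x => chernoff_factor r g w (rV_of_tuple (f x)) (rV_of_tuple (h x))).
Proof.
move=> mf mh; apply: measurable_funD; last first.
  apply: measurable_funM => //; apply: measurable_natr_bool.
  apply: measurable_fun_eqr => //; apply: measurable_dotp => j //.
  exact: measurable_rV_of_tuple.
apply: measurable_funB => //; apply: measurable_funM => //.
apply: measurable_natr_bool; apply: measurable_fun_ler => //.
apply: measurable_enorm => j.
rewrite (_ : (fun x => _) = fun x => (rV_of_tuple (h x) 0 j -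
    (1 - r / 2) * rV_of_tuple (f x) 0 j)%R); last first.
  by apply/funext => x; rewrite !mxE.
apply: measurable_funB; first exact: measurable_rV_of_tuple.
by apply: measurable_funM => //; exact: measurable_rV_of_tuple.
Qed.

Let measurable_phi {D} {T : measurableType D} (f h : T -> d.-tuple R) :
  measurable_fun setT f -> measurable_fun setT h ->
  measurable_fun setT (fun x => phi (rV_of_tuple (f x)) (rV_of_tuple (h x))).
Proof.
move=> mf mh; apply: measurable_funM; last exact: measurable_chernoff.
by apply: measurable_funM; exact: measurable_B.
Qed.

Let phi_ge0 y x : (0 <= phi y x)%R.
Proof. by rewrite /phi !mulr_ge0// chernoff_factor_ge0. Qed.

Lemma hyperplane_null :
  iter_integral (fun c : d.-tuple R => (dotp w (rV_of_tuple c) == 0)%R%:R%:E) = 0.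
Proof.
rewrite -[RHS](iter_integral_hyperplane _ (fun j => w 0%R j) 0%R).
  apply: eq_iter_integral => c; congr (nat_of_bool (_ == _))%:R%:E.
  by apply: eq_bigr => j _; rewrite mxE.
apply: contrapT => /forallNP w0; move: w1; rewrite /enorm /dotp big1.
  by rewrite sqrtr0 => /eqP; rewrite eq_sym oner_eq0.
by move=> j _; have /negP := w0 j; rewrite negbK => /eqP ->; rewrite mul0r.
Qed.

(** The shrunk ball has volume [(r / 2) ^+ d * V] and the hyperplane has none, so integrating the
    factor over the unit ball leaves [V - 2 * a * V]. *)
Let phi_integral_le y :
  iter_integral (fun c : d.-tuple R => (phi y (rV_of_tuple c))%:E) <=
  (V * (1 - 2 * a))%:E.
Proof.
have [r0 r1] := andP r01.
have [ball_V _] := iter_integral_ball (R := R) _ d0; rewrite -/V in ball_V.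
have a01 : (0 <= 1 - 2 * a)%R.
  have rd1 : ((r / 2) ^+ d <= 1)%R by apply: exprn_ile1; lra.
  have g4 : (g ^+ 2 <= 1 / 4)%R.
    have [g0 g1] := andP g01.
    have : (0 <= (1 / 2 - g) * (1 / 2 + g))%R by apply: mulr_ge0; lra.
    by rewrite expr2; lra.
  have := ler_wpM2r (sqr_ge0 g) rd1; rewrite -/a; lra.
have [y1|y1] := boolP (enorm y <= 1)%R; last first.
  rewrite [leLHS](_ : _ = 0); first by rewrite lee_fin mulr_ge0// ltW.
  rewrite -[RHS](iter_integral0 d); apply: eq_iter_integral => c.
  by rewrite /phi /B (negbTE y1) !mul0r.
have mid : measurable_fun setT (fun c : d.-tuple R => c) by [].
pose z := ((1 - r / 2) *: y)%R.
pose S (c : d.-tuple R) : R := (enorm (rV_of_tuple c - z) <= r / 2)%R%:R.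
pose H (c : d.-tuple R) : R := (dotp w (rV_of_tuple c) == 0)%R%:R.
have mS : measurable_fun setT S.
  apply: measurable_natr_bool; apply: measurable_fun_ler => //.
  apply: measurable_enorm => j.
  rewrite (_ : (fun x => _) = fun x => (rV_of_tuple x 0 j - z 0 j)%R); last first.
    by apply/funext => x; rewrite !mxE.
  by apply: measurable_funB => //; exact: measurable_rV_of_tuple.
have mH : measurable_fun setT H.
  apply: measurable_natr_bool.
  apply: measurable_fun_eqr => //; apply: measurable_dotp => j //.
  exact: measurable_rV_of_tuple.
have S0 c : (0 <= S c)%R by [].
have H0 c : (0 <= H c)%R by [].
have gg : (0 <= 2 * g ^+ 2)%R by rewrite mulr_ge0// sqr_ge0.
have mphi : measurable_fun setT (fun c : d.-tuple R => (phi y (rV_of_tuple c))).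
  rewrite (_ : (fun c => _) = fun c =>
      phi (rV_of_tuple [tuple y 0%R j | j < d]) (rV_of_tuple c)).
    by apply: measurable_phi => //; exact: measurable_cst.
  apply/funext => c; congr (phi _ _).
  by apply/rowP => j; rewrite mxE tnth_mktuple.
(* The negative term is moved to the left so that only nonnegative integrands are added. *)
have key : iter_integral (fun c : d.-tuple R => (phi y (rV_of_tuple c))%:E) +
    (2 * g ^+ 2)%:E * iter_integral (fun c => (S c)%:E) <=
    V%:E + 2%:E * iter_integral (fun c => (H c)%:E).
  rewrite -ball_V -!iter_integralZl ?lee_fin//; try exact/measurable_EFinP.
  rewrite -!iter_integralD; try by move=> c; rewrite -?EFinM lee_fin ?mulr_ge0.
  apply: le_iter_integral => c.
    by rewrite -EFinM -EFinD lee_fin addr_ge0// mulr_ge0.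
  rewrite -!EFinM -!EFinD lee_fin /phi /B y1 mul1r /chernoff_factor -/z.
  rewrite -/(S c) -/(H c).
  (* The shrunk ball stays inside the unit ball, so the cut-off by [B] does not reduce its
     contribution. *)
  have : (S c = 1 -> enorm (rV_of_tuple c) <= 1)%R.
    rewrite /S; case: leP => [h _|_ /eqP]; last by rewrite eq_sym oner_eq0.
    by have [] := shrunk_ball_sub _ _ _ r01 y1 h.
  have : (S c = 0 \/ S c = 1)%R by rewrite /S; case: (_ <= _)%R; [right|left].
  case=> ->; case: (enorm _ <= 1)%R => /= h; rewrite ?mul1r ?mul0r;
    have Hc := H0 c; rewrite ?mulr1 ?mulr0; lra.
all: try exact/measurable_EFinP/measurable_B.
all: try exact/measurable_funeM/measurable_EFinP.
all: try exact/measurable_EFinP.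
all: try by move=> c; rewrite lee_fin; exact: phi_ge0.
all: try by move=> c; apply: mule_ge0; rewrite lee_fin.
move: key; rewrite hyperplane_null mule0 adde0.
rewrite iter_integral_ball_affine//; last by lra.
rewrite -EFinM -leeBrDr// -EFinB => /le_trans; apply.
by rewrite lee_fin -/V /a le_eqVlt; apply/orP; left; apply/eqP; ring.
Qed.

(** The integrand is at least [ind] minus the sum of the [G i]. The first integrates to [V ^+ m.+1],
    each [G i] to at most [V ^+ m.+1 * (1 - 2 * a) ^+ m]; dividing by [V ^+ m.+1] gives the
    bound. *)
Lemma prob_far_correct_ge m (q : (m.+1 * d).-tuple R -> 'I_m.+1 -> R) :
  (forall c i, 1 / 2 + g <= q c i <= 1)%R ->
  (1 - m.+1%:R * (1 - 2 * a) ^+ m)%:E <= prob_far_correct r w q.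
Proof.
move=> q01.
pose ind (c : (m.+1 * d).-tuple R) : R := (\prod_i B (sensor_pos c i))%R.
pose G (i : 'I_m.+1) (c : (m.+1 * d).-tuple R) : R :=
  (B (sensor_pos c i) *
   \prod_(j < m.+1 | j != i) phi (sensor_pos c i) (sensor_pos c j))%R.
pose F (c : (m.+1 * d).-tuple R) : R :=
  (if all_in_unit_ball c then cond_prob_correct r w q c else 0)%R.
(* A measurable minorant of [F], truncated at 0 so that the additivity of nonnegative integrals
   applies to it; [F] enters by monotonicity alone. *)
pose psi c : R := Num.max 0%R (ind c - \sum_i G i c)%R.
have mid : measurable_fun setT (fun c : d.-tuple R => c) by [].
have indE c : ind c = (all_in_unit_ball c)%:R by exact: prodr_natr_bool.
have mind : measurable_fun setT ind.
  apply: measurable_prod => i _.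
  by apply: (measurable_block1 _ _ B); exact: measurable_B.
have mphi2 : measurable_fun setT (fun p : d.-tuple R * d.-tuple R =>
    phi (rV_of_tuple p.1) (rV_of_tuple p.2)) by exact: measurable_phi.
have mG i : measurable_fun setT (G i).
  apply: measurable_funM.
    by apply: (measurable_block1 _ _ B); exact: measurable_B.
  under eq_fun do rewrite big_mkcond.
  apply: measurable_prod => j _; case: (j != i) => //.
  exact: (measurable_block2 _ _ _ phi).
have mpsi : measurable_fun setT psi.
  apply: measurable_maxr => //; apply: measurable_funB => //.
  exact: measurable_sum.
have ind0 c : (0 <= ind c)%R by apply: prodr_ge0.
have G0 i c : (0 <= G i c)%R by rewrite mulr_ge0// prodr_ge0.
have psi0 c : (0 <= psi c)%R by rewrite le_max lexx.
have psiF c : (psi c <= F c)%R.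
  rewrite /psi indE /F; case: ifPn => [/forallP c1|_]; last first.
    by rewrite ge_max lexx sub0r oppr_le0 sumr_ge0.
  rewrite ge_max; apply/andP; split.
    apply: sumr_ge0 => s _; rewrite mulr_ge0//; last by case: ifP.
    have [g0 _] := andP g01.
    by apply: prodr_ge0 => i _; have := q01 c i; case: ifP; lra.
  rewrite lerBlDr.
  apply: le_trans
    (correct_prob_lower _ _ _ (sensor_pos c) (q c) g01 r01 w1 _ _) _ => //.
  rewrite lerD2l; apply: ler_sum => i _.
  (* All positions are in the ball, so every indicator equals 1 and [G i] is the product of the
     factors. *)
  rewrite /G /B c1 mul1r le_eqVlt; apply/orP; left; apply/eqP.
  by apply: eq_bigr => j _; rewrite /phi /B !c1 !mul1r.
have K0 : (0 <= V * (1 - 2 * a))%R.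
  rewrite -lee_fin; apply: le_trans (phi_integral_le 0%R).
  by apply: iter_integral_ge0 => c; rewrite lee_fin.
have Jind : iter_integral (fun c => (ind c)%:E) = (V ^+ m.+1)%:E.
  apply: iter_integral_prod_blocks => //; first exact: measurable_B.
  by have [] := iter_integral_ball (R := R) _ d0.
have JG i :
    iter_integral (fun c => (G i c)%:E) <= ((V * (1 - 2 * a)) ^+ m * V)%:E.
  apply: le_trans
    (iter_integral_star_le m i B phi _ _ mphi2 _ _ phi_integral_le) _ => //.
    exact: measurable_B.
  by have [-> _] := iter_integral_ball (R := R) _ d0; rewrite -EFinM.
have key : (V ^+ m.+1)%:E <= iter_integral (fun c => (F c)%:E) +
    (m.+1%:R * ((V * (1 - 2 * a)) ^+ m * V))%:E.
  apply: (@le_trans _ _ (iter_integral (fun c => (psi c)%:E) +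
      \sum_(i < m.+1) iter_integral (fun c => (G i c)%:E))).
    rewrite -Jind -iter_integral_sum.
    - rewrite -iter_integralD.
      + apply: le_iter_integral => c; first by rewrite lee_fin.
        by rewrite sumEFin -EFinD lee_fin -lerBlDr /psi le_max lexx orbT.
      + exact/measurable_EFinP.
      + by move=> c; rewrite lee_fin.
      + by apply: emeasurable_sum => i; exact/measurable_EFinP.
      + by move=> c; apply: sume_ge0 => i _; rewrite lee_fin.
    - by move=> i; exact/measurable_EFinP.
    - by move=> i c; rewrite lee_fin.
  apply: leeD.
    by apply: le_iter_integral => c; rewrite lee_fin.
  apply: le_trans (lee_sum _ (fun i _ => JG i)) _.
  by rewrite sumEFin lee_fin sumr_const card_ord -[leLHS]mulr_natl.
rewrite /prob_far_correct -/V.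
have Vn : (0 < V ^+ m.+1)%R by exact: exprn_gt0.
rewrite lee_pdivlMl//.
move: key; rewrite -leeBlDr// => /(le_trans _); apply.
rewrite -EFinM -EFinB lee_fin exprMn exprS.
by rewrite le_eqVlt; apply/orP; left; apply/eqP; ring.
Qed.

End separator.

Theorem theorem2 (R : realType) (d N : nat) (w : 'rV[R]_d) (r eta delta : R)
    (q : (N * d).-tuple R -> 'I_N -> R) :
  (1 <= d)%N ->
  enorm w = 1 ->
  0 < r <= 1 ->
  0 <= eta < 1 / 2 ->
  0 < delta < 1 ->
  (forall i, measurable_fun [set: (N * d).-tuple R] (fun c => q c i)) ->
  (forall c i, 1 - eta <= q c i <= 1) ->
  2 / ((r / 2) ^+ d * (1 / 2 - eta) ^+ 2)
      * ln (1 / ((r / 2) ^+ d * (1 / 2 - eta) ^+ 2 * delta)) + 1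
    <= (N%:R : R) ->
  ((1 - delta)%:E <= prob_far_correct r w q)%E.
Proof.
move=> d0 w1 r01 eta01 delta01 _ q01.
set g := 1 / 2 - eta; set a := (r / 2) ^+ d * g ^+ 2 => hN.
have g01 : 0 <= g <= 1 / 2 by rewrite /g; lra.
have a01 : 0 < a <= 1 / 2.
  have rd0 : 0 < (r / 2) ^+ d by apply: exprn_gt0; lra.
  have rd1 : (r / 2) ^+ d <= 1 by apply: exprn_ile1; lra.
  have g0 : 0 < g by rewrite /g; lra.
  have g4 : g ^+ 2 <= 1 / 4.
    have : 0 <= (1 / 2 - g) * (1 / 2 + g) by apply: mulr_ge0; lra.
    by rewrite expr2; lra.
  have := ler_wpM2r (sqr_ge0 g) rd1; rewrite -/a => ag.
  by rewrite {1}/a mulr_gt0 ?exprn_gt0//=; lra.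
(* [N = 0] contradicts the hypothesis: [a * delta <= 1] makes the logarithm nonnegative, so the
   required bound is at least 1. *)
case: N q q01 hN => [|m] q q01 hN.
  exfalso; suff : 0 <= 2 / a * ln (1 / (a * delta)) by lra.
  apply: mulr_ge0; first by apply: divr_ge0 => //; lra.
  have ad0 : 0 < a * delta by apply: mulr_gt0; lra.
  apply: ln_ge0; rewrite ler_pdivlMr// mul1r.
  by apply: mulr_ile1; lra.
(* The summand 1 cancels: the exponent [m] counts the sensors other than [i]. *)
rewrite -(natr1 m) lerD2r in hN.
apply: le_trans (prob_far_correct_ge r g w d0 g01 r01 w1 m q _).
  by rewrite lee_fin lerD2l lerN2; exact: union_bound_le.
by move=> c i; have := q01 c i; rewrite /g; lra.
Qed.
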